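(* Let $R$ be a unitary ring with involution $*$, let $a\in R$ and $m\in\mathbb{N}$. If $a$ is $m$-weak group invertible and $x\in R$ is one of the $m$-weak group inverses of $a$, then $a$ is $(m+1)$-weak group invertible and $x^{2}a$ is one of the $(m+1)$-weak group inverses of $a$.
   Context: $R$ is an associative ring with identity $1$ equipped with an involution, i.e. a map $a\mapsto a^{*}$ with $(a+b)^{*}=a^{*}+b^{*}$, $(ab)^{*}=b^{*}a^{*}$, $(a^{*})^{*}=a$ for all $a,b\in R$. $\mathbb{N}$ is the set of nonnegative integers, $\mathbb{N}^{+}$ the set of positive integers, and $a^{0}=1$ for every $a\in R$. $m$-weak group inverse: for $a\in R$ and $m\in\mathbb{N}$, an element $x\in R$ is called an $m$-weak group inverse of $a$ if there exists $k\in\mathbb{N}^{+}$ such that $xa^{k+1}=a^{k}$, $ax^{2}=x$, and $(a^{k})^{*}a^{m+1}x=(a^{k})^{*}a^{m}$. It need not be unique; $a$ is $m$-weak group invertible if it has at least one $m$-weak group inverse. *)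

(* Defs.v *)
From mathcomp Require Import all_boot all_algebra.

Set Implicit Arguments.
Unset Strict Implicit.
Unset Printing Implicit Defensive.

Local Open Scope ring_scope.

(* pzRingType rather than nzRingType: the zero ring is an associative ring
   with identity and is not excluded. *)
Definition ring_involution (R : pzRingType) (star : R -> R) : Prop :=
  [/\ forall a b, star (a + b) = star a + star b,
      forall a b, star (a * b) = star b * star a
    & forall a, star (star a) = a].

Definition mweak_group_inverse (R : pzRingType) (star : R -> R) (m : nat)
    (a x : R) : Prop :=
  exists k : nat,
    [/\ (0 < k)%N,
        x * a ^+ k.+1 = a ^+ k,
        a * x ^+ 2 = x
      & star (a ^+ k) * a ^+ m.+1 * x = star (a ^+ k) * a ^+ m].

Definition mweak_group_invertible (R : pzRingType) (star : R -> R) (m : nat)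
    (a : R) : Prop :=
  exists x : R, mweak_group_inverse star m a x.

(* Main.v *)
Require Import Defs.
From mathcomp Require Import all_boot all_algebra.

Import GRing.Theory.
Local Open Scope ring_scope.

(** Replacing x by x ^+ 2 * a keeps the exponent k: the relation a * x ^+ 2 = x
    lets one more factor a on the left cancel one factor x, which turns
    a ^+ m.+2 * (x ^+ 2 * a) into a ^+ m.+1 * x * a, and the trailing a then
    raises a ^+ m to a ^+ m.+1. *)
Theorem proposition4p8 (R : pzRingType) (star : R -> R)
    (hstar : ring_involution star) (a : R) (m : nat)
    (ha : mweak_group_invertible star m a)
    (x : R) (hx : mweak_group_inverse star m a x) :
  mweak_group_invertible star m.+1 a /\
  mweak_group_inverse star m.+1 a (x ^+ 2 * a).
Proof.
suff hy : mweak_group_inverse star m.+1 a (x ^+ 2 * a).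
  by split=> //; exists (x ^+ 2 * a).
have [k [k_gt0 xak ax2 sax]] := hx.
exists k; split=> //.
- (* Each of the two factors x absorbs one factor a, since x * a ^+ k.+1 = a ^+ k. *)
  have xak1 : x * a ^+ k.+2 = a ^+ k.+1 by rewrite exprSr mulrA xak -exprSr.
  by rewrite -mulrA -exprS expr2 -mulrA xak1.
- (* a * x ^+ 2 = x contracts (a * x ^+ 2) * (a * x ^+ 2) * a to x * x * a. *)
  have axx : a * x * x = x by rewrite -mulrA -expr2.
  by rewrite !expr2 !mulrA axx -(mulrA x a) -(mulrA x) axx.
(* a ^+ m.+2 * x ^+ 2 = a ^+ m.+1 * x, so the third equation for x applies,
   and the trailing factor a raises the exponent from m to m.+1. *)
have amx : a ^+ m.+2 * x ^+ 2 = a ^+ m.+1 * x by rewrite exprSr -mulrA ax2.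
by rewrite mulrA -(mulrA (star _)) amx mulrA sax -mulrA -exprSr.
Qed.
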